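(* Consider the following algorithm for the Graph Reconstruction problem with a Maximal Independent Set oracle. It is given the vertex set $V$ ($|V|=n$) of an unknown graph $G=(V,E)$, the maximum degree $\Delta$ of $G$, and a constant $C$. For $i=1,\dots,C\cdot(\Delta+1)^2\cdot\log n$, it draws a random subset $V_i\subseteq V$ that contains each vertex independently with probability $\frac{1}{\Delta+1}$, and submits $V_i$ to the oracle, receiving $I_i$. It outputs the graph $(V,\hat E)$, where $\hat E=\{uv : u,v\in V,\ u\neq v,\ \text{there is no } i \text{ with } \{u,v\}\subseteq I_i\}$. Then, for a sufficiently large constant $C$, this algorithm executes $O(\Delta^2\log n)$ Maximal Independent Set queries and, with high probability, correctly reconstructs the input graph, i.e.\ outputs $\hat E=E$, for every input graph of maximum degree $\Delta$.
   Context: Graph Reconstruction problem: an algorithm initially knows only the vertex set $V$ of an unknown simple undirected input graph $G=(V,E)$ and must determine $E$. Access to $G$ is only via a Maximal Independent Set oracle: in each query the algorithm submits a subset $U\subseteq V$, and the oracle returns an arbitrary (possibly adversarially chosen) maximal independent set of the induced subgraph $G[U]$. The query complexity is the number of oracle calls. ''With high probability'' means with probability at least $1-1/\mathrm{poly}(n)$, where $n=|V|$. *)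

(* Defs.v *)
From HB Require Import structures.
From mathcomp Require Import all_boot all_order all_algebra.
From mathcomp Require Import reals exp.

Set Implicit Arguments.
Unset Strict Implicit.
Unset Printing Implicit Defensive.

Import Order.TTheory GRing.Theory Num.Theory.
Local Open Scope ring_scope.

(* A simple graph on T is a symmetric irreflexive e : rel T. *)

Definition max_degree (T : finType) (e : rel T) : nat :=
  (\max_(v : T) #|[set w | e v w]|)%N.

Definition independent (T : finType) (e : rel T) (I : {set T}) : bool :=
  [forall u in I, forall v in I, ~~ e u v].

Definition is_mis (T : finType) (e : rel T) (U I : {set T}) : bool :=
  maxset [pred J : {set T} | (J \subset U) && independent e J] I.

(* The (query, answer) pairs exchanged so far, oldest first. *)
Definition transcript (T : finType) := seq ({set T} * {set T}).

(* The adversary may be adaptive: its answer to a query may depend on the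
   whole past interaction, so repeated queries may get different answers. *)
Definition oracle (T : finType) := transcript T -> {set T} -> {set T}.

Definition mis_oracle (T : finType) (e : rel T) (O : oracle T) : Prop :=
  forall (h : transcript T) (U : {set T}), is_mis e U (O h U).

Definition ask (T : finType) (O : oracle T) (h : transcript T) (U : {set T}) :
  transcript T := rcons h (U, O h U).

Definition interact (T : finType) (O : oracle T) (Vs : seq {set T}) :
  transcript T := foldl (ask O) [::] Vs.

(* C (D + 1)^2 ln n, rounded up to an integer. *)
Definition rounds (R : realType) (C : R) (D n : nat) : nat :=
  `|Num.ceil (C * (D.+1)%:R ^+ 2 * ln (n%:R : R))|%N.

(* One run of the algorithm: V lists the sets drawn in the successive rounds.
   The input graph is accessed only through O. *)
Definition run (T : finType) (O : oracle T) (q : nat)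
    (V : {ffun 'I_q -> {set T}}) : transcript T := interact O (codom V).

Definition output (T : finType) (h : transcript T) : rel T :=
  fun u v => (u != v) &&
    ~~ has (fun qa : {set T} * {set T} => (u \in qa.2) && (v \in qa.2)) h.

Definition reconstructs (T : finType) (e : rel T) (O : oracle T) (q : nat)
    (V : {ffun 'I_q -> {set T}}) : bool :=
  [forall u, forall v, output (run O V) u v == e u v].

(* Law of q independent random subsets of T, each of which contains each
   vertex independently with probability p. *)
Definition draw_weight (R : realType) (T : finType) (p : R) (q : nat)
    (V : {ffun 'I_q -> {set T}}) : R :=
  \prod_(i < q) \prod_(v : T) (if v \in V i then p else 1 - p).

Definition draw_Pr (R : realType) (T : finType) (p : R) (q : nat)
    (A : pred {ffun 'I_q -> {set T}}) : R :=
  \sum_(V | A V) draw_weight p V.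

Lemma draw_Pr_predT (R : realType) (T : finType) (p : R) (q : nat) :
  draw_Pr p (@predT {ffun 'I_q -> {set T}}) = 1.
Proof.
rewrite /draw_Pr /draw_weight.
rewrite -(bigA_distr_bigA (fun (_ : 'I_q) (U : {set T}) =>
  \prod_(v : T) (if v \in U then p else 1 - p))).
apply: big1 => i _.
transitivity (\prod_(v : T) \sum_(b : bool) (if b then p else 1 - p)).
  rewrite bigA_distr_bigA /=.
  rewrite (reindex (fun f : {ffun T -> bool} => [set v | f v])) /=.
    by apply: eq_bigr => f _; apply: eq_bigr => v _; rewrite inE.
  exists (fun U : {set T} => [ffun v => v \in U]) => [f|U] _.
    by apply/ffunP => v; rewrite ffunE inE.
  by apply/setP => v; rewrite inE ffunE.
by apply: big1 => v _; rewrite big_bool /= addrC subrK.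
Qed.

(* Main.v *)
Require Import Defs.
From HB Require Import structures.
From mathcomp Require Import all_boot all_order all_algebra.
From mathcomp Require Import reals exp.
From mathcomp Require Import sequences ring zify.

Set Implicit Arguments.
Unset Strict Implicit.
Unset Printing Implicit Defensive.

Import Order.TTheory GRing.Theory Num.Theory.
Local Open Scope ring_scope.

(** If a query contains the nonadjacent vertices u and v but none of their
    neighbours, then every maximal independent set of it contains both, so the
    round reveals that uv is not an edge whatever the adaptive adversary answers.
    This event concerns the drawn set alone and has probability at least
    p^2 (1 - p)^(2D) >= e^-2 / (D+1)^2 for p = 1/(D+1); it is therefore missed in
    all of C (D+1)^2 ln n independent rounds with probability at most
    n^(- C e^-2).  A union bound over the n^2 pairs gives failure probability at
    most n^-c as soon as C >= (c + 2) e^2. *)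

(** * Maximal independent sets and the adaptive oracle *)

Section Oracle.
Variables (T : finType) (e : rel T) (O : oracle T).
Hypotheses (esym : symmetric e) (eirr : irreflexive e) (OP : mis_oracle e O).

Lemma interact_rcons (Vs : seq {set T}) (U : {set T}) :
  interact O (rcons Vs U) =
  rcons (interact O Vs) (U, O (interact O Vs) U).
Proof. by rewrite /interact foldl_rcons. Qed.

Lemma size_interact (Vs : seq {set T}) : size (interact O Vs) = size Vs.
Proof.
by elim/last_ind: Vs => // Vs U IH; rewrite interact_rcons !size_rcons IH.
Qed.

(** The history is existential because an adaptive answer depends on it; this suffices since
    [mis_oracle] constrains the answer under every history. *)
Lemma interact_query (Vs : seq {set T}) (U : {set T}) :
  U \in Vs -> exists h, (U, O h U) \in interact O Vs.
Proof.
elim/last_ind: Vs => // Vs W IH; rewrite interact_rcons mem_rcons inE.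
case/predU1P => [->|/IH[h hU]].
  by exists (interact O Vs); rewrite mem_rcons mem_head.
by exists h; rewrite mem_rcons inE hU orbT.
Qed.

Lemma interact_answer (Vs : seq {set T}) (qa : {set T} * {set T}) :
  qa \in interact O Vs -> exists h, qa.2 = O h qa.1.
Proof.
elim/last_ind: Vs => // Vs W IH; rewrite interact_rcons mem_rcons inE.
by case/predU1P => [->|/IH//]; exists (interact O Vs).
Qed.

Lemma size_run (q : nat) (V : {ffun 'I_q -> {set T}}) : size (run O V) = q.
Proof. by rewrite size_interact size_codom card_ord. Qed.

(** No vertex of [I] is adjacent to [u], so [u |: I] is still an independent subset of [U], and
    maximality forces it to equal [I]. *)
Lemma mis_isolated (U I : {set T}) (u : T) :
  is_mis e U I -> u \in U -> [disjoint U & [set w | e u w]] -> u \in I.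
Proof.
move=> /maxsetP[/andP[sIU /forall_inP indI] maxI] uU disj.
have nadj w : w \in I -> ~~ e u w.
  move=> wI; have wU := subsetP sIU _ wI.
  by move/disjointFr: disj => /(_ _ wU); rewrite inE => ->.
rewrite -(maxI (u |: I)) ?setU11 ?subsetUr //=.
rewrite subUset sub1set uU sIU /=.
apply/forall_inP => x /setU1P xP; apply/forall_inP => y /setU1P yP.
case: xP yP => [->|xI] [->|yI]; first by rewrite eirr.
- exact: nadj.
- by rewrite esym nadj.
- by move/forall_inP: (indI _ xI) => ->.
Qed.

Definition isolates (u v : T) (U : {set T}) : bool :=
  ([set u; v] \subset U) &&
  [disjoint U & [set w | e u w] :|: [set w | e v w]].

(** The error is one-sided: answers are independent sets, so an edge is never ruled out, and only
    non-edges need a round that isolates them. *)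
Lemma isolates_reconstructs (q : nat) (V : {ffun 'I_q -> {set T}}) :
  (forall u v, u != v -> ~~ e u v -> exists i, isolates u v (V i)) ->
  reconstructs e O V.
Proof.
move=> iso; apply/forallP => u; apply/forallP => v; rewrite /output.
have [->|uv] /= := eqVneq u v; first by rewrite eirr.
have [euv|neuv] := boolP (e u v).
  rewrite eqb_id; apply/hasPn => qa /interact_answer[h ->].
  have /maxsetP[/andP[_ /forall_inP ind] _] := OP h qa.1.
  apply/andP => -[uI vI].
  by have /forall_inP/(_ _ vI) := ind _ uI; rewrite euv.
have [i /andP[]] := iso _ _ uv neuv.
rewrite subUset !sub1set => /andP[uVi vVi].
rewrite -setI_eq0 setIUr setU_eq0 !setI_eq0 => /andP[du dv].
rewrite eqbF_neg negbK; apply/hasP.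
have [h hV] : exists h, (V i, O h (V i)) \in run O V.
  by apply: interact_query; exact: codom_f.
by exists (V i, O h (V i)) => //=; rewrite !(mis_isolated (OP h (V i))).
Qed.

End Oracle.

(** * Law of the drawn sets *)

Section Draw.
Variables (R : realType) (T : finType) (p : R).
Hypotheses (p0 : 0 <= p) (p1 : p <= 1).

Definition set_weight (U : {set T}) : R :=
  \prod_(v : T) (if v \in U then p else 1 - p).

Lemma set_weight_ge0 (U : {set T}) : 0 <= set_weight U.
Proof. by apply: prodr_ge0 => v _; case: ifP; rewrite ?subr_ge0. Qed.

Lemma sum_set_weight_between (A B : {set T}) : [disjoint A & B] ->
  \sum_(U : {set T} | (A \subset U) && [disjoint U & B]) set_weight U =
  p ^+ #|A| * (1 - p) ^+ #|B|.
Proof.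
move=> AB.
(* [F1] and [F2] weigh a vertex inside and outside [U]. Their zeros encode the constraint, so the
   sum can range over all [U] and factor over vertices; an unconstrained vertex contributes
   [p + (1 - p) = 1]. *)
pose F1 w := if w \in B then 0 else p.
pose F2 w := if w \in A then 0 else 1 - p.
transitivity (\sum_(U : {set T}) \prod_w (if w \in U then F1 w else F2 w)).
  rewrite big_mkcond /=; apply: eq_bigr => U _; case: ifPn => [|].
    case/andP=> sAU UB; apply: eq_bigr => w _; rewrite /F1 /F2.
    case: ifPn => wU; first by rewrite (disjointFr UB wU).
    by rewrite (contraNF (subsetP sAU w) wU).
  rewrite negb_and => /orP[/subsetPn[w wA wU]|].
    by rewrite (bigD1 w) //= (negPf wU) /F2 wA mul0r.
  rewrite -setI_eq0 => /set0Pn[w /setIP[wU wB]].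
  by rewrite (bigD1 w) //= wU /F1 wB mul0r.
rewrite -bigA_distr.
transitivity (\prod_w ((if w \in A then p else 1) *
                       (if w \in B then 1 - p else 1))).
  apply: eq_bigr => w _; rewrite /F1 /F2.
  case: (boolP (w \in A)) => [wA|_].
    by rewrite (disjointFr AB wA) /= addr0 mulr1.
  by case: ifP => _ /=; rewrite mul1r ?add0r // addrC subrK.
by rewrite big_split -!big_mkcond !prodr_const.
Qed.

Lemma sum_set_weight : \sum_(U : {set T}) set_weight U = 1.
Proof.
have := @sum_set_weight_between set0 set0; rewrite !cards0 !expr0 mulr1.
move=> <-; last by rewrite -setI_eq0 setI0.
by apply: eq_bigl => U; rewrite sub0set -setI_eq0 setI0 eqxx.
Qed.

Lemma draw_weight_ge0 (q : nat) (V : {ffun 'I_q -> {set T}}) :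
  0 <= draw_weight p V.
Proof. by apply: prodr_ge0 => i _; exact: set_weight_ge0. Qed.

(** Independence of the rounds: the sum over families expands a product of [q] equal sums. *)
Lemma draw_Pr_forall (q : nat) (P : pred {set T}) :
  draw_Pr p (fun V : {ffun 'I_q -> {set T}} => [forall i, P (V i)]) =
  (\sum_(U | P U) set_weight U) ^+ q.
Proof.
rewrite -[in RHS](card_ord q) -prodr_const.
rewrite (bigA_distr_big_dep (fun _ : 'I_q => P) (fun _ U => set_weight U)).
apply: eq_bigl => V; apply/forallP/familyP => VP i; exact: VP.
Qed.

(** Union bound on the complement: after exchanging the sums, each [V] outside [A] is counted at
    least once, and all weights are nonnegative. *)
Lemma draw_Pr_union (q : nat) (I : finType) (J : pred I)
    (A : pred {ffun 'I_q -> {set T}})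
    (B : I -> pred {ffun 'I_q -> {set T}}) :
  (forall V, ~~ A V -> exists2 j, J j & B j V) ->
  1 - \sum_(j | J j) draw_Pr p (B j) <= draw_Pr p A.
Proof.
move=> AB; rewrite -(draw_Pr_predT T p q) /draw_Pr (bigID A) /=.
rewrite lerBlDr lerD2l [leRHS](eq_bigr
  (fun j => \sum_V if B j V then draw_weight p V else 0)); last first.
  by move=> j _; rewrite big_mkcond.
rewrite exchange_big big_mkcond /=; apply: ler_sum => V _.
have ge0 j : 0 <= if B j V then draw_weight p V else 0.
  by case: ifP => // _; exact: draw_weight_ge0.
case: ifPn => [/AB[j Jj BjV]|_]; last by apply: sumr_ge0.
by rewrite (bigD1 j) //= BjV lerDl sumr_ge0.
Qed.

End Draw.

(** * Probability that one round misses a non-edge *)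

(* Inverted, this is (1 + 1/D)^D <= e. *)
Lemma expRN1_le_expr (R : realType) (D : nat) :
  expR (- 1) <= (1 - D.+1%:R^-1 : R) ^+ D.
Proof.
(* For [D = 0] the base is 0, and the bound holds because its zeroth power is 1. *)
case: D => [|D]; first by rewrite expr0 -[leRHS]expR0 ler_expR lerN10.
have D0 : (D.+1%:R : R) != 0 by rewrite pnatr_eq0.
have D2 : (D.+2%:R : R) != 0 by rewrite pnatr_eq0.
have -> : (1 - D.+2%:R^-1 : R) = (1 + D.+1%:R^-1)^-1.
  have -> : (D.+2%:R : R) = D.+1%:R + 1 by rewrite -natr1.
  have D2' : (D.+1%:R + 1 : R) != 0 by rewrite natr1.
  by move: (D.+1%:R : R) D0 D2' => x x0 x1; field; rewrite x0 x1.
rewrite exprVn expRN lef_pV2 ?posrE ?expR_gt0 ?exprn_gt0 ?addr_gt0 ?invr_gt0 ?ltr0n //.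
rewrite -[X in expR X](mulVf D0).
by rewrite expRM_natr lerXn2r ?nnegrE ?expR_ge0 ?expR_ge1Dx ?addr_ge0 ?invr_ge0.
Qed.

Lemma sum_not_isolates_le (R : realType) (T : finType) (e : rel T) (u v : T) :
  irreflexive e -> symmetric e -> u != v -> ~~ e u v ->
  \sum_(U | ~~ isolates e u v U) set_weight (max_degree e).+1%:R^-1 U <=
  expR (- (expR (- 2) / (max_degree e).+1%:R ^+ 2)) :> R.
Proof.
move=> eirr esym uv euv; set d : R := (max_degree e).+1%:R.
have d0 : 0 < d by rewrite ltr0n.
have p0 : 0 <= d^-1 by rewrite invr_ge0 ltW.
have p1 : d^-1 <= 1 by rewrite invf_le1 // ler1n.
set B := [set w | e u w] :|: [set w | e v w].
have AB : [disjoint [set u; v] & B].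
  rewrite -setI_eq0; apply/eqP/setP => w; rewrite !inE.
  apply/andP => -[/orP[]/eqP->]; rewrite !eirr ?orbF /=.
    by rewrite esym (negPf euv).
  by rewrite (negPf euv).
have degP w : (#|[set x | e w x]| <= max_degree e)%N.
  exact: (leq_bigmax (F := fun w => #|[set x | e w x]|)).
have cB : (#|B| <= max_degree e * 2)%N.
  by rewrite muln2 -addnn (leq_trans (leq_card_setU _ _)) // leq_add.
have := sum_set_weight T d^-1; rewrite (bigID (isolates e u v)) /=.
rewrite (sum_set_weight_between _ AB) cards2 uv => tot.
(* By [1 - x <= expR (- x)], it remains to bound the probability of isolation from below by [x]. *)
apply: (le_trans _ (expR_ge1Dx _)).
rewrite -[X in _ <= X + _]tot [leRHS]addrAC lerDr subr_ge0.
rewrite mulrC exprVn ler_wpM2l ?invr_ge0 ?exprn_ge0 ?ler0n //.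
have q0 : 0 <= 1 - d^-1 by rewrite subr_ge0.
(* The base lies in [[0, 1]], so raising the exponent from [#|B|] to twice the maximum degree only
   lowers the power. *)
apply: (@le_trans _ _ ((1 - d^-1) ^+ (max_degree e * 2))); last first.
  by rewrite ler_wiXn2l // lerBlDr lerDl.
have -> : - 2 = - 1 * 2%:R :> R by ring.
by rewrite expRM_natr exprM lerXn2r ?nnegrE ?expR_ge0 ?exprn_ge0 ?expRN1_le_expr.
Qed.

(** * Number of rounds and total failure probability *)

Lemma rounds_bounds (R : realType) (C : R) (D n : nat) : 0 <= C ->
  C * D.+1%:R ^+ 2 * ln (n%:R : R) <= (rounds C D n)%:R
    <= C * D.+1%:R ^+ 2 * ln (n%:R : R) + 1.
Proof.
move=> C0; have l0 : 0 <= ln (n%:R : R).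
  (* The convention [ln 0 = 0] covers [n = 0]. *)
  by case: n => [|n]; [rewrite ln0|rewrite ln_ge0 ?ler1n].
set x := C * _ * _; have x0 : 0 <= x by rewrite !mulr_ge0 ?exprn_ge0.
(* Hence the absolute value in [rounds] leaves the ceiling unchanged. *)
have c0 : 0 <= Num.ceil x by rewrite -(ler_int R) (le_trans x0) ?ceil_ge.
have -> : (rounds C D n)%:R = (Num.ceil x)%:~R :> R.
  by rewrite /rounds natr_absz ger0_norm.
rewrite ceil_ge /=; have := ltW (ceilB1_lt x).
by rewrite intrB lerBlDr.
Qed.

Lemma ln_nat_le1 (R : realType) (n : nat) : (n <= 1)%N -> ln (n%:R : R) = 0.
Proof. by case: n => [|[|//]] _; rewrite ?ln1 ?ln0. Qed.

(** The factor 4 comes from [D + 1 <= 2 * maxn 1 D], and [(ln 2)^-1 * ln n >= 1] absorbs the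
    rounding when [n >= 2]. For smaller [n] the logarithm is 0 and there are no rounds. *)
Lemma rounds_le (R : realType) (C : R) (D n : nat) : 0 <= C ->
  (rounds C D n)%:R <=
  (4 * C + (ln 2)^-1) * (maxn 1 D)%:R ^+ 2 * ln (n%:R : R).
Proof.
move=> C0; have [n1|n2] := leqP n 1.
  by rewrite /rounds ln_nat_le1 // !mulr0 ceil0.
have /andP[_ ub] := rounds_bounds D n C0; apply: (le_trans ub).
set m : R := (maxn 1 D)%:R; set l := ln _.
have m1 : 1 <= m by rewrite ler1n leq_maxl.
have l20 : 0 < ln 2 :> R by rewrite ln_gt0 // ltr1n.
have l2 : ln 2 <= l by rewrite ler_ln ?posrE ?ltr0n ?ler_nat // (ltn_trans _ n2).
have Dm : D.+1%:R <= 2 * m :> R.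
  by rewrite -natrM ler_nat; case: (D) => // k; rewrite maxnE; lia.
have l0 : 0 <= l by rewrite ltW // (lt_le_trans l20).
have m21 : 1 <= m ^+ 2 by rewrite exprn_ege1.
rewrite 2!mulrDl; apply: lerD.
  rewrite ler_wpM2r // [4 * C]mulrC -mulrA ler_wpM2l //.
  have -> : 4 * m ^+ 2 = (2 * m) ^+ 2 by ring.
  by rewrite lerXn2r ?nnegrE // (le_trans _ Dm).
rewrite mulrAC -[leLHS]mulr1 ler_pM //.
by rewrite mulrC ler_pdivlMr // mul1r.
Qed.

Lemma failure_le (R : realType) (c : nat) (C : R) (D n : nat) :
  (0 < n)%N -> (c%:R + 2) * expR 2 <= C ->
  (n ^ 2)%:R * expR (- (expR (- 2) / D.+1%:R ^+ 2)) ^+ rounds C D n <=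
  (n%:R ^+ c)^-1 :> R.
Proof.
move=> n0 hC.
have C0 : 0 <= C by rewrite (le_trans _ hC) // mulr_ge0 ?expR_ge0 // addr_ge0.
have nR : 0 < n%:R :> R by rewrite ltr0n.
have l0 : 0 <= ln (n%:R : R) by rewrite ln_ge0 // ler1n.
have nE k : (n%:R : R) ^+ k = expR (ln n%:R * k%:R).
  by rewrite expRM_natr lnK // posrE.
rewrite natrX !nE -expRM_natr -expRN -expRD ler_expR.
have /andP[lb _] := rounds_bounds D n C0.
set d : R := D.+1%:R in lb *; set l := ln _ in lb l0 *.
have d0 : 0 < d ^+ 2 by rewrite exprn_gt0 // ltr0n.
(* In logarithms, the 2 pays for the [n ^ 2] pairs and [c] is the exponent that remains; the square
   of [d] cancels against the number of rounds. *)
have key : l * (c%:R + 2) <= expR (- 2) / d ^+ 2 * (rounds C D n)%:R.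
  apply: (@le_trans _ _ (expR (- 2) / d ^+ 2 * (C * d ^+ 2 * l))); last first.
    by rewrite ler_wpM2l // divr_ge0 ?expR_ge0 ?ltW.
  have -> : expR (- 2) / d ^+ 2 * (C * d ^+ 2 * l) = l * (C * expR (- 2)).
    have : d != 0 by rewrite pnatr_eq0.
    by move: (d) => y y0; field.
  rewrite ler_wpM2l //.
  by rewrite expRN ler_pdivlMr ?expR_gt0.
by rewrite mulNr lerBlDr addrC -lerBlDr opprK -mulrDr [2 + _]addrC.
Qed.

Theorem theorem1 (R : realType) (c : nat) :
  exists2 C0 : R, 0 < C0 & forall C : R, C0 <= C ->
    exists K : R,
      forall (T : finType) (e : rel T), symmetric e -> irreflexive e ->
      forall O : oracle T, mis_oracle e O ->
      forall n D : nat, n = #|T| -> D = max_degree e ->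
        (forall V : {ffun 'I_(rounds C D n) -> {set T}},
           (size (run O V))%:R <= K * (maxn 1 D)%:R ^+ 2 * ln (n%:R : R)) /\
        1 - (n%:R ^+ c)^-1 <=
          draw_Pr (D.+1%:R^-1 : R)
            (fun V : {ffun 'I_(rounds C D n) -> {set T}} =>
               reconstructs e O V).
Proof.
exists ((c%:R + 2) * expR 2) => [|C hC].
  by rewrite mulr_gt0 ?expR_gt0 // ltr_wpDl.
have C0 : 0 <= C by rewrite (le_trans _ hC) // mulr_ge0 ?expR_ge0 // addr_ge0.
exists (4 * C + (ln 2)^-1) => T e esym eirr O OP n D nT DE; split=> [V|].
  by rewrite size_run rounds_le.
set q := rounds C D n.
have p0 : 0 <= D.+1%:R^-1 :> R by rewrite invr_ge0.
have p1 : D.+1%:R^-1 <= 1 :> R by rewrite invf_le1 ?ler1n ?ltr0n.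
(* The bad events are indexed by ordered non-adjacent pairs, at most [n ^ 2] of them. *)
pose J := [pred uv : T * T | (uv.1 != uv.2) && ~~ e uv.1 uv.2].
pose B (uv : T * T) := [pred V : {ffun 'I_q -> {set T}} |
  [forall i, ~~ isolates e uv.1 uv.2 (V i)]].
have cover (V : {ffun 'I_q -> {set T}}) :
    ~~ reconstructs e O V -> exists2 uv, J uv & B uv V.
  move=> nrec; have [/exists_inP[uv Juv Buv]|] := boolP [exists uv in J, B uv V].
    by exists uv.
  rewrite negb_exists_in => /forall_inP noB; case/negP: nrec.
  apply: isolates_reconstructs => // u v uv euv.
  have := noB (u, v); rewrite inE /= uv euv => /(_ isT).
  by rewrite negb_forall => /existsP[i]; rewrite negbK; exists i.
apply: (le_trans _ (draw_Pr_union p0 p1 cover)); rewrite lerD2l lerN2.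
(* With no vertices there are no pairs and the sum is 0; [failure_le] handles positive [n]. *)
have [n0|n0] := posnP n.
  rewrite big1 ?invr_ge0 ?exprn_ge0 // => -[u v] _.
  by have := max_card (pred1 u); rewrite card1 -nT n0.
apply: (le_trans _ (failure_le D n0 hC)).
set x : R := expR _.
apply: (@le_trans _ _ (\sum_(uv : T * T) x ^+ q)); last first.
  by rewrite sumr_const card_prod -nT -mulnn mulr_natl.
rewrite big_mkcond; apply: ler_sum => -[u v] _.
case: ifPn => [/andP[/= uv euv]|_]; last by rewrite exprn_ge0 ?expR_ge0.
rewrite (draw_Pr_forall _ _ (fun U => ~~ isolates e u v U)).
have := sum_not_isolates_le R eirr esym uv euv; rewrite -DE /= => le1.
rewrite lerXn2r ?nnegrE ?expR_ge0 //.
by apply: sumr_ge0 => U _; exact: set_weight_ge0.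
Qed.
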